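(* Let $\mathfrak g$ be the Lie superalgebra of type $G(3)$. Then $$J(\mathfrak g)=\big\{f=g(w)+(v-u_1)(v-u_2)(v-u_3)h\ \big|\ h\in\mathbb Z[u_1,u_2,u_3,v]^{S_3},\ g\in\mathbb Z[w]\big\}.$$
   Context: For $G(3)$, $\mathfrak g_0=G(2)\oplus\mathfrak{sl}(2)$, and $\mathfrak h^*$ is spanned by $\varepsilon_1,\varepsilon_2,\varepsilon_3,\delta$ with $\varepsilon_1+\varepsilon_2+\varepsilon_3=0$, where $(\varepsilon_i,\varepsilon_i)=2$, $(\varepsilon_i,\varepsilon_j)=-1$ $(i\neq j)$, $(\delta,\delta)=-2$, $(\varepsilon_i,\delta)=0$. The isotropic roots are $\pm\varepsilon_i\pm\delta$. The weight lattice of $\mathfrak g_0$ is $P_0=\{\lambda_1\varepsilon_1+\lambda_2\varepsilon_2+\mu\delta:\lambda_1,\lambda_2,\mu\in\mathbb Z\}$, and $W_0=D_6\times\mathbb Z_2$, where $D_6$ (order 12) acts on $\varepsilon_1,\varepsilon_2,\varepsilon_3$ by permutations and simultaneous sign change, and $\mathbb Z_2$ changes the sign of $\delta$. Put $x_1=e^{\varepsilon_1}$, $x_2=e^{\varepsilon_2}$, $y=e^\delta$. The ring $J(\mathfrak g)=\{f\in\mathbb Z[P_0]^{W_0}: D_\alpha f\in(e^\alpha-1)\text{ for every isotropic root }\alpha\}$ (with $D_\alpha e^\beta=(\alpha,\beta)e^\beta$ and principal ideals in the group ring) is $$J(\mathfrak g)=\Big\{f\in\mathbb Z[x_1^{\pm1},x_2^{\pm1},y^{\pm1}]^{W_0}\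 \Big|\ x_1\frac{\partial f}{\partial x_1}+x_2\frac{\partial f}{\partial x_2}+2y\frac{\partial f}{\partial y}\in(y-x_1x_2)\Big\},$$ where $W_0$ is generated by the permutation of $x_1,x_2$, the transformations $x_1\mapsto(x_1x_2)^{-1},x_2\mapsto x_2$ and $x_1\mapsto x_1^{-1},x_2\mapsto x_2^{-1}$, and $y\mapsto y^{-1}$. Notation: $u_1=x_1+x_1^{-1}$, $u_2=x_2+x_2^{-1}$, $u_3=x_1x_2+x_1^{-1}x_2^{-1}$, $v=y+y^{-1}$, $$w=v^2-v(u_1+u_2+u_3+1)+u_1u_2+u_1u_3+u_2u_3.$$ $\mathbb Z[u_1,u_2,u_3,v]$ denotes the subring of $\mathbb Z[x_1^{\pm1},x_2^{\pm1},y^{\pm1}]$ generated by these elements, and $S_3$ acts on it by permuting $u_1,u_2,u_3$ (induced by the permutations of $\varepsilon_1,\varepsilon_2,\varepsilon_3$). *)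

(* Defs.v *)
From HB Require Import structures.
From mathcomp Require Import all_boot all_order all_fingroup all_algebra.
From mathcomp Require Import finmap.
From mathcomp.multinomials Require Import monalg.

Set Implicit Arguments.
Unset Strict Implicit.
Unset Printing Implicit Defensive.

Import GRing.Theory.
Local Open Scope fset_scope.
Local Open Scope ring_scope.

(* Group ring R[A] of an additive group A.  [monalg] only gives {malg R[K]} a
   ring structure when the monoid K has no nontrivial unit, which excludes
   groups, so the convolution product is put here on an alias of {malg R[A]}. *)
Definition grpring (R : comNzRingType) (A : zmodType) : Type := {malg R[A]}.

HB.instance Definition _ (R : comNzRingType) (A : zmodType) :=
  GRing.Zmodule.on (grpring R A).

Section GroupRing.
Variables (R : comNzRingType) (A : zmodType).
Implicit Types (f g : grpring R A) (k l : A) (c : R).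

(* grpmon c k = c e^k *)
Definition grpmon c k : grpring R A := mkmalgU k c.
Definition grpexp k : grpring R A := grpmon 1 k.
Definition grpmul f g : grpring R A :=
  \sum_(k <- msupp f) \sum_(l <- msupp g) grpmon (f@_k * g@_l) (k + l).

Lemma grpmon0 k : grpmon 0 k = 0.
Proof. exact: monalgU0. Qed.

Lemma grpmonD c1 c2 k : grpmon (c1 + c2) k = grpmon c1 k + grpmon c2 k.
Proof. exact: monalgUD. Qed.

Lemma grpringE f : f = \sum_(k <- msupp f) grpmon f@_k k.
Proof. exact: monalgE. Qed.

Lemma grpmulw (d1 d2 : {fset A}) f g :
  msupp f `<=` d1 -> msupp g `<=` d2 ->
  grpmul f g = \sum_(k <- d1) \sum_(l <- d2) grpmon (f@_k * g@_l) (k + l).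
Proof.
move=> le_d1 le_d2; rewrite /grpmul (big_fset_incl _ le_d1) /=.
  apply/eq_bigr=> k1 _; apply/big_fset_incl => // k _ /mcoeff_outdom ->.
  by rewrite mulr0 grpmon0.
move=> k _ /mcoeff_outdom fk.
by rewrite big1 => // k' _; rewrite fk mul0r grpmon0.
Qed.

Lemma grpmulC : commutative grpmul.
Proof.
move=> f g; rewrite /grpmul exchange_big /=; apply/eq_bigr=> k _.
by apply/eq_bigr=> l _; rewrite mulrC addrC.
Qed.

Lemma grpmul0g : left_zero 0 grpmul.
Proof. by move=> g; rewrite /grpmul msupp0 big_seq_fset0. Qed.

Lemma grpmulUg c k g :
  grpmul (grpmon c k) g = \sum_(l <- msupp g) grpmon (c * g@_l) (k + l).
Proof.
rewrite (grpmulw (msuppU_le : msupp (grpmon c k) `<=` _) (fsubset_refl _)).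
rewrite big_seq_fset1; apply/eq_bigr => l _.
by rewrite [(grpmon c k)@_k]mcoeffUU.
Qed.

Lemma grpmulUU c1 c2 k1 k2 :
  grpmul (grpmon c1 k1) (grpmon c2 k2) = grpmon (c1 * c2) (k1 + k2).
Proof.
rewrite (grpmulw (msuppU_le : msupp (grpmon c1 k1) `<=` _)
                 (msuppU_le : msupp (grpmon c2 k2) `<=` _)).
by rewrite !big_seq_fset1 [(grpmon c1 _)@__]mcoeffUU [(grpmon c2 _)@__]mcoeffUU.
Qed.

Lemma grpmul1g : left_id (grpexp 0) grpmul.
Proof.
move=> g; rewrite /grpexp grpmulUg [RHS]grpringE.
by apply/eq_bigr=> k _; rewrite mul1r add0r.
Qed.

Lemma grpmulDl : left_distributive grpmul +%R.
Proof.
move=> g1 g2 g.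
rewrite (grpmulw (fsubsetUl (msupp g1) (msupp g2)) (fsubset_refl (msupp g))).
rewrite (grpmulw (fsubsetUr (msupp g1) (msupp g2)) (fsubset_refl (msupp g))).
rewrite (grpmulw (msuppD_le g1 g2) (fsubset_refl (msupp g))).
rewrite -big_split /=; apply/eq_bigr=> k _.
rewrite -big_split /=; apply/eq_bigr=> l _.
by rewrite [(g1 + g2)@_k]mcoeffD mulrDl grpmonD.
Qed.

Lemma grpmulDr : right_distributive grpmul +%R.
Proof. by move=> f g h; rewrite !(grpmulC f) grpmulDl. Qed.

Lemma grpmulg0 : right_zero 0 grpmul.
Proof. by move=> g; rewrite grpmulC grpmul0g. Qed.

Lemma grpmulEl f g : grpmul f g = \sum_(k <- msupp f) grpmul (grpmon f@_k k) g.
Proof. by apply/eq_bigr=> k _; rewrite grpmulUg. Qed.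

Lemma grpmulEr f g : grpmul f g = \sum_(k <- msupp g) grpmul f (grpmon g@_k k).
Proof.
by rewrite grpmulC grpmulEl; apply/eq_bigr=> k _; rewrite grpmulC.
Qed.

Lemma grpmulA : associative grpmul.
Proof.
move=> g1 g2 g3.
have suml (I : seq A) (F : A -> grpring R A) g :
    grpmul (\sum_(i <- I) F i) g = \sum_(i <- I) grpmul (F i) g.
  exact: (big_morph (grpmul^~ g) (fun _ _ => grpmulDl _ _ _) (grpmul0g _)).
have sumr (I : seq A) (F : A -> grpring R A) g :
    grpmul g (\sum_(i <- I) F i) = \sum_(i <- I) grpmul g (F i).
  exact: (big_morph (grpmul g) (fun _ _ => grpmulDr _ _ _) (grpmulg0 _)).
rewrite grpmulEl (grpmulEl g1 g2) suml; apply/eq_bigr=> k1 _.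
rewrite (grpmulEl g2 g3) sumr (grpmulEr (grpmon _ _) g2) suml.
apply/eq_bigr=> k2 _; rewrite (grpmulEr (grpmon _ k2)) sumr.
by rewrite (grpmulEr _ g3); apply/eq_bigr=> k3 _; rewrite !grpmulUU mulrA addrA.
Qed.

Lemma grpexp0_neq0 : grpexp 0 != 0.
Proof. by rewrite [_ == _]monalgU_eq0 oner_eq0. Qed.

HB.instance Definition _ := GRing.Zmodule_isComNzRing.Build (grpring R A)
  grpmulA grpmulC grpmul1g grpmulDl grpexp0_neq0.

Lemma grpexp0 : grpexp 0 = 1.
Proof. by []. Qed.

Lemma grpexpD k l : grpexp (k + l) = grpexp k * grpexp l.
Proof. by rewrite [RHS]grpmulUU mulr1. Qed.

(* The R-linear maps induced by e^k |-> e^(phi k) and e^k |-> d k *: e^k. *)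
Definition grpmap (phi : A -> A) f : grpring R A :=
  \sum_(k <- msupp f) grpmon f@_k (phi k).
Definition grpder (d : A -> R) f : grpring R A :=
  \sum_(k <- msupp f) grpmon (d k * f@_k) k.

End GroupRing.

Inductive subring_gen (R : nzRingType) (S : R -> Prop) : R -> Prop :=
| subring_gen_base x : S x -> subring_gen S x
| subring_gen_1 : subring_gen S 1
| subring_gen_B x y :
    subring_gen S x -> subring_gen S y -> subring_gen S (x - y)
| subring_gen_M x y :
    subring_gen S x -> subring_gen S y -> subring_gen S (x * y).

(* The triple (l1, l2, m) stands for l1 eps_1 + l2 eps_2 + m delta; the
   eps_1, eps_2, eps_3 are indexed from 0, and eps_3 = - eps_1 - eps_2. *)
Definition P0 : zmodType := (int * int * int)%type.

Definition eps (i : 'I_3) : P0 :=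
  match val i with
  | 0%N => (1, 0, 0)
  | 1%N => (0, 1, 0)
  | _ => (-1, -1, 0)
  end.
Definition delta : P0 := (0, 0, 1).

Definition bform (a b : P0) : int :=
  2 * (a.1.1 * b.1.1 + a.1.2 * b.1.2) - (a.1.1 * b.1.2 + a.1.2 * b.1.1)
  - 2 * (a.2 * b.2).

Lemma sum_eps : \sum_i eps i = 0.
Proof. by rewrite !big_ord_recl big_ord0. Qed.

Lemma bform_eps i j : bform (eps i) (eps j) = if i == j then 2 else -1.
Proof. by case: i j => [[|[|[|?]]] ?] [[|[|[|?]]] ?]. Qed.

Lemma bform_delta : bform delta delta = -2.
Proof. by []. Qed.

Lemma bform_eps_delta i : bform (eps i) delta = 0.
Proof. by case: i => [[|[|[|?]]] ?]. Qed.

Definition isotropic_root (a : P0) : Prop :=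
  exists (i : 'I_3) (b c : bool), a = eps i *~ (-1) ^+ b + delta *~ (-1) ^+ c.

(* The element of W_0 permuting the eps_i by s and changing the sign of all
   the eps_i if b, and of delta if c; W_0 consists of the 24 maps of this form. *)
Definition weyl (s : 'S_3) (b c : bool) (l : P0) : P0 :=
  (eps (s 0) *~ l.1.1 + eps (s 1) *~ l.1.2) *~ (-1) ^+ b
  + delta *~ ((-1) ^+ c * l.2).

Lemma weyl_eps s b c i : weyl s b c (eps i) = eps (s i) *~ (-1) ^+ b.
Proof.
rewrite /weyl; case: i => [[|[|[|//]]] lti] /=; rewrite mulr0 !mulr0z.
- by rewrite mulr1z !addr0; congr (eps (s _) *~ _); apply/val_inj.
- by rewrite mulr1z add0r addr0; congr (eps (s _) *~ _); apply/val_inj.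
rewrite addr0 !mulrN1z -opprD; congr (_ *~ _).
have := sum_eps; rewrite (reindex_inj (@perm_inj _ s)) /= !big_ord_recl big_ord0.
have -> : Ordinal lti = lift ord0 (lift ord0 ord0) by apply/val_inj.
have -> : 1 = lift ord0 ord0 :> 'I_3 by apply/val_inj.
by rewrite addr0 addrA => /eqP; rewrite addr_eq0 => /eqP ->; rewrite opprK.
Qed.

Lemma weyl_delta s b c : weyl s b c delta = delta *~ (-1) ^+ c.
Proof. by rewrite /weyl /= !mulr0z addr0 mul0rz add0r mulr1. Qed.

Notation ZP0 := (grpring int P0).

Notation "''e^' a" := (grpexp int (a : P0)) (at level 8, a at level 2).

Definition weyl_act (s : 'S_3) (b c : bool) : ZP0 -> ZP0 :=
  grpmap (weyl s b c).

Definition D (a : P0) : ZP0 -> ZP0 := grpder (bform a).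

(* The ring J(g) for g of type G(3). *)
Definition J (f : ZP0) : Prop :=
  (forall s b c, weyl_act s b c f = f) /\
  (forall a, isotropic_root a -> exists q : ZP0, D a f = q * ('e^a - 1)).

Definition u (i : 'I_3) : ZP0 := 'e^(eps i) + 'e^(- eps i).
Definition u1 : ZP0 := u 0.
Definition u2 : ZP0 := u 1.
Definition u3 : ZP0 := u 2.
Lemma u3E :
  u3 = 'e^(eps 0) * 'e^(eps 1) + 'e^(- eps 0) * 'e^(- eps 1).
Proof.
rewrite -!grpexpD -opprD [RHS]addrC.
by congr (_ + _); congr (grpexp _ _); apply/eqP.
Qed.

Definition v : ZP0 := 'e^delta + 'e^(- delta).
Definition w : ZP0 :=
  v ^+ 2 - v * (u1 + u2 + u3 + 1) + u1 * u2 + u1 * u3 + u2 * u3.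

(* The subring Z[u_1, u_2, u_3, v], and its S_3-invariants.  The u_i are
   algebraically dependent, so S_3 acts by permuting the eps_i. *)
Definition Zuv (h : ZP0) : Prop :=
  subring_gen (fun x => x = v \/ exists i, x = u i) h.
Definition ZuvS3 (h : ZP0) : Prop :=
  Zuv h /\ forall s, weyl_act s false false h = h.

(* Main.v *)
Require Import Defs.
From HB Require Import structures.
From mathcomp Require Import all_boot all_order all_fingroup all_algebra.
From mathcomp Require Import finmap ring zify.
From mathcomp.multinomials Require Import monalg.

Import GRing.Theory.
Local Open Scope ring_scope.

Set Implicit Arguments.
Unset Strict Implicit.
Unset Printing Implicit Defensive.

(* For an isotropic root a with delta-coordinate 1, reduction modulo (e^a - 1) is
   the map proj_a induced by k |-> k - k_delta a.  As (a, a) = 0, it commutes with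
   D_a, so for f in J the image proj_a f is supported on the line spanned by
   t = eps_1 - eps_2 when a = delta + eps_3, and it is symmetric by W_0-invariance:
   it is a polynomial g in e^t + e^(-t) = proj_a w.  Then f - g(w) is divisible by
   e^a - 1, hence, by invariance, by e^b - 1 for the six roots b = delta +- eps_i,
   and by their product, which is a unit times (v - u_1)(v - u_2)(v - u_3).  The
   quotient is W_0-invariant, and summing over orbits of sign changes shows that
   it lies in Z[u_1, u_2, u_3, v]. *)

(** * Group rings: induced maps, derivations, zero divisors, orbit sums *)

Section GroupRingTheory.
Variables (R : comNzRingType) (A : zmodType).
Implicit Types (f g : grpring R A) (k l : A) (c : R) (phi : A -> A).

Lemma grpring_ind (Q : grpring R A -> Prop) :
  Q 0 -> (forall f g, Q f -> Q g -> Q (f + g)) ->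
  (forall c k, Q (grpmon c k)) -> forall f, Q f.
Proof. by move=> Q0 QD QU f; rewrite [f]grpringE; apply: big_ind. Qed.

Lemma grpringP f g : (forall k, f@_k = g@_k) -> f = g.
Proof. by move=> e; apply/malgP. Qed.

Lemma grpcoefD f g k : (f + g)@_k = f@_k + g@_k.
Proof. exact: mcoeffD. Qed.

Lemma grpcoefB f g k : (f - g)@_k = f@_k - g@_k.
Proof. exact: mcoeffB. Qed.

Lemma grpcoef0 k : (0 : grpring R A)@_k = 0.
Proof. exact: mcoeff0. Qed.

Lemma grpcoefU c l k : (grpmon c l)@_k = c *+ (l == k).
Proof. exact: mcoeffU. Qed.

Lemma grpmonM c1 c2 k1 k2 :
  grpmon c1 k1 * grpmon c2 k2 = grpmon (c1 * c2) (k1 + k2).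
Proof. exact: grpmulUU. Qed.

Lemma grpexp_unit k : grpexp R k * grpexp R (- k) = 1.
Proof. by rewrite -grpexpD subrr. Qed.

Section LinearExtension.
Variable F : A -> R -> grpring R A.
Hypotheses (F0 : forall k, F k 0 = 0)
           (FD : forall k c1 c2, F k (c1 + c2) = F k c1 + F k c2).

(** Points outside the support contribute [F k 0 = 0], so sums over different supports can be
    brought to a common range. *)
Lemma sum_msuppw f (d : {fset A}) : (msupp f `<=` d)%fset ->
  \sum_(k <- msupp f) F k f@_k = \sum_(k <- d) F k f@_k.
Proof. by move=> le_d; apply/big_fset_incl => // k _ /mcoeff_outdom ->. Qed.

Lemma sum_msuppD f g :
  \sum_(k <- msupp (f + g)) F k (f + g)@_k =
  \sum_(k <- msupp f) F k f@_k + \sum_(k <- msupp g) F k g@_k.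
Proof.
rewrite (sum_msuppw (msuppD_le f g)) (sum_msuppw (fsubsetUl _ (msupp g))).
rewrite (sum_msuppw (fsubsetUr (msupp f) _)) -big_split /=.
by apply: eq_bigr => k _; rewrite grpcoefD.
Qed.

Lemma sum_msuppU c k : \sum_(l <- msupp (grpmon c k)) F l (grpmon c k)@_l = F k c.
Proof.
by rewrite (sum_msuppw msuppU_le) big_seq_fset1 grpcoefU eqxx.
Qed.
End LinearExtension.

Lemma grpmapU phi c k : grpmap phi (grpmon c k) = grpmon c (phi k).
Proof.
rewrite /grpmap (@sum_msuppU (fun k c => grpmon c (phi k))) // => l; exact: grpmon0.
Qed.

Lemma grpmapD phi : {morph @grpmap R A phi : f g / f + g}.
Proof.
move=> f g; rewrite /grpmap (@sum_msuppD (fun k c => grpmon c (phi k))) // => *.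
  exact: grpmon0.
exact: grpmonD.
Qed.

Lemma grpmap0 phi : grpmap phi 0 = 0 :> grpring R A.
Proof. by apply: (addrI (grpmap phi 0)); rewrite -grpmapD !addr0. Qed.

Lemma grpmap_is_zmod_morphism phi : zmod_morphism (@grpmap R A phi).
Proof.
move=> f g; apply: (addIr (grpmap phi g)).
by rewrite -grpmapD !subrK.
Qed.

Lemma grpmapB phi : {morph @grpmap R A phi : f g / f - g}.
Proof. exact: grpmap_is_zmod_morphism. Qed.

HB.instance Definition _ phi := GRing.isZmodMorphism.Build
  (grpring R A) (grpring R A) (grpmap phi) (grpmap_is_zmod_morphism phi).

Lemma grpmap_comp phi1 phi2 f : grpmap phi1 (grpmap phi2 f) = grpmap (phi1 \o phi2) f.
Proof.
elim/grpring_ind: f => [|f g IHf IHg|c k].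
- by rewrite !grpmap0.
- by rewrite !grpmapD IHf IHg.
- by rewrite !grpmapU.
Qed.

Lemma eq_grpmap phi1 phi2 f : phi1 =1 phi2 -> grpmap phi1 f = grpmap phi2 f.
Proof. by move=> e; apply: eq_bigr => k _; rewrite e. Qed.

Lemma grpcoef_map_inj phi f k : injective phi -> (grpmap phi f)@_(phi k) = f@_k.
Proof.
move=> phiI; elim/grpring_ind: f => [|f g IHf IHg|c l].
- by rewrite grpmap0 !grpcoef0.
- by rewrite grpmapD !grpcoefD IHf IHg.
- by rewrite grpmapU !grpcoefU (inj_eq phiI).
Qed.

Lemma grpcoef_map_neq0 phi f k : (grpmap phi f)@_k != 0 -> exists l, k = phi l.
Proof.
elim/grpring_ind: f => [|f g IHf IHg|c l].
- by rewrite grpmap0 grpcoef0 eqxx.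
- rewrite grpmapD grpcoefD.
  have [->|/IHf//] := eqVneq (grpmap phi f)@_k 0.
  by rewrite add0r => /IHg.
- rewrite grpmapU grpcoefU; have [<- _|_] := phi l =P k; first by exists l.
  by rewrite mulr0n eqxx.
Qed.

Definition grpsym k : grpring R A := grpexp R k + grpexp R (- k).

Lemma grpsymN k : grpsym (- k) = grpsym k.
Proof. by rewrite /grpsym opprK addrC. Qed.

Lemma grpsymM k l : grpsym k * grpsym l = grpsym (k + l) + grpsym (k - l).
Proof. rewrite /grpsym !opprD opprK !grpexpD; ring. Qed.

(** For [k = delta] and [l = eps i] this writes [v - u i] as a unit times the two factors e^b - 1
    with b = delta - eps_i and b = delta + eps_i. *)
Lemma grpsymB k l :
  grpsym k - grpsym l =
  grpexp R (- k) * (grpexp R (k - l) - 1) * (grpexp R (k + l) - 1).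
Proof.
rewrite /grpsym !grpexpD.
transitivity (grpexp R k * grpexp R (- k) *
    (grpexp R k * (grpexp R l * grpexp R (- l)) - grpexp R l - grpexp R (- l))
  + grpexp R (- k)); last by ring.
by rewrite !grpexp_unit; ring.
Qed.

Section MapMorphism.
Variable phi : {additive A -> A}.

Lemma grpmap_is_monoid_morphism : monoid_morphism (@grpmap R A phi).
Proof.
split=> [|f g]; first by rewrite -[1]/(grpmon 1 0) grpmapU raddf0.
elim/grpring_ind: f => [|f1 f2 IH1 IH2|c k].
- by rewrite mul0r raddf0 mul0r.
- by rewrite mulrDl !raddfD /= mulrDl IH1 IH2.
elim/grpring_ind: g => [|f1 f2 IH1 IH2|d l].
- by rewrite mulr0 raddf0 mulr0.
- by rewrite mulrDr !raddfD /= mulrDr IH1 IH2.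
by rewrite grpmonM !grpmapU grpmonM raddfD.
Qed.

HB.instance Definition _ := GRing.isMonoidMorphism.Build
  (grpring R A) (grpring R A) (grpmap phi) grpmap_is_monoid_morphism.

Lemma grpmap_exp k : grpmap phi (grpexp R k) = grpexp R (phi k).
Proof. exact: grpmapU. Qed.

Lemma grpmap1 : grpmap phi 1 = 1 :> grpring R A.
Proof. by case: grpmap_is_monoid_morphism. Qed.

Lemma grpmapM : {morph @grpmap R A phi : f g / f * g}.
Proof. by case: grpmap_is_monoid_morphism. Qed.

Lemma grpmap_expB1 k : grpmap phi (grpexp R k - 1) = grpexp R (phi k) - 1.
Proof. by rewrite grpmapB grpmap_exp grpmap1. Qed.

Lemma grpmap_sym k : grpmap phi (grpsym k) = grpsym (phi k).
Proof. by rewrite /grpsym grpmapD !grpmap_exp raddfN. Qed.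
End MapMorphism.

Section Derivation.
Variable d : A -> R.

Lemma grpderU c k : grpder d (grpmon c k) = grpmon (d k * c) k.
Proof.
rewrite /grpder (@sum_msuppU (fun k c => grpmon (d k * c) k)) => * //;
  by rewrite ?mulr0 ?grpmon0 // mulrDr grpmonD.
Qed.

Lemma grpderD : {morph @grpder R A d : f g / f + g}.
Proof.
move=> f g; rewrite /grpder (@sum_msuppD (fun k c => grpmon (d k * c) k)) => * //;
  by rewrite ?mulr0 ?grpmon0 // mulrDr grpmonD.
Qed.

Lemma grpder_is_zmod_morphism : zmod_morphism (@grpder R A d).
Proof. by move=> f g; apply: (addIr (grpder d g)); rewrite -grpderD !subrK. Qed.

HB.instance Definition _ := GRing.isZmodMorphism.Build
  (grpring R A) (grpring R A) (grpder d) grpder_is_zmod_morphism.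

Lemma grpcoef_der f k : (grpder d f)@_k = d k * f@_k.
Proof.
elim/grpring_ind: f => [|f g IHf IHg|c l].
- by rewrite raddf0 !grpcoef0 mulr0.
- by rewrite raddfD !grpcoefD IHf IHg mulrDr.
- by rewrite grpderU !grpcoefU; case: eqP => [->|]; rewrite ?mulr0.
Qed.

Lemma grpderM (dD : {morph d : k l / k + l}) f g :
  grpder d (f * g) = grpder d f * g + f * grpder d g.
Proof.
elim/grpring_ind: f => [|f1 f2 IH1 IH2|c k].
- by rewrite !(mul0r, raddf0) add0r.
- by rewrite mulrDl !raddfD /= IH1 IH2 !mulrDl addrACA.
elim/grpring_ind: g => [|f1 f2 IH1 IH2|e l].
- by rewrite !(mulr0, raddf0) add0r.
- by rewrite mulrDr !raddfD /= IH1 IH2 !mulrDr addrACA.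
rewrite grpmonM !grpderU !grpmonM -grpmonD dD; congr (grpmon _ _).
by rewrite mulrDl mulrA mulrCA.
Qed.

(** Both [d a] and [d 0] vanish, so the derivation kills e^a - 1 and only one Leibniz term survives;
    in particular the ideal (e^a - 1) is stable. *)
Lemma grpder_expB1_mul (dD : {morph d : k l / k + l}) a f :
  d a = 0 -> grpder d (f * (grpexp R a - 1)) = grpder d f * (grpexp R a - 1).
Proof.
move=> da; rewrite grpderM //.
have -> : grpder d (grpexp R a - 1) = 0.
  apply/grpringP => k; rewrite grpcoef_der grpcoefB !grpcoefU grpcoef0 mulrBr.
  have d0 : d 0 = 0 by apply: (addIr (d 0)); rewrite -dD !add0r.
  have dk l : d l = 0 -> d k * (1 *+ (l == k)) = 0.
    by case: eqP => [-> ->|_ _]; rewrite ?mul0r ?mulr0.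
  by rewrite !dk ?subrr.
by rewrite mulr0 addr0.
Qed.

Lemma grpder_sym k : d k = 0 -> d (- k) = 0 -> grpder d (grpsym k) = 0.
Proof. by move=> dk dNk; rewrite grpderD !grpderU dk dNk !mul0r !grpmon0 addr0. Qed.
End Derivation.

Lemma eq_grpder (d1 d2 : A -> R) f : d1 =1 d2 -> grpder d1 f = grpder d2 f.
Proof. by move=> e; apply: eq_bigr => k _; rewrite e. Qed.

Lemma grpder_map (d : A -> R) phi f :
  grpder d (grpmap phi f) = grpmap phi (grpder (d \o phi) f).
Proof.
elim/grpring_ind: f => [|f g IHf IHg|c k].
- by rewrite grpmap0 !raddf0.
- by rewrite !(grpmapD, grpderD) IHf IHg.
- by rewrite !(grpmapU, grpderU).
Qed.

(** If e^k f = f, the coefficients of f are constant along translation by k. The translates of a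
    point are pairwise distinct and the support is finite, so all coefficients vanish. *)
Lemma grpexpB1_lreg k f :
  injective (fun n : nat => k *+ n) -> (grpexp R k - 1) * f = 0 -> f = 0.
Proof.
move=> kI; rewrite mulrBl mul1r => /eqP; rewrite subr_eq0 => /eqP ef.
have coef_shift l : (grpexp R k * f)@_(k + l) = f@_l.
  elim/grpring_ind: f {ef} => [|f1 f2 IH1 IH2|c j].
  - by rewrite mulr0 !grpcoef0.
  - by rewrite mulrDr !grpcoefD IH1 IH2.
  - by rewrite grpmonM mul1r !grpcoefU (inj_eq (addrI k)).
have coefn l n : f@_(k *+ n + l) = f@_l.
  elim: n => [|n IHn]; first by rewrite mulr0n add0r.
  by rewrite mulrS -addrA -{1}ef coef_shift IHn.
apply/grpringP => l; rewrite grpcoef0; apply/eqP/negPn/negP => fl.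
(* One more translate of [l] than the support has points; f would be nonzero at each of them. *)
pose s := [seq k *+ n + l | n <- iota 0 (size (msupp f)).+1].
have us : uniq s.
  by rewrite map_inj_uniq ?iota_uniq // => m n /addIr /kI.
have := uniq_leq_size us (s2 := msupp f).
rewrite size_map size_iota ltnn => H; apply/notF/H => _ /mapP[n _ ->].
by rewrite -mcoeff_neq0 coefn.
Qed.

(* [orb] enumerates the classes of an equivalence relation with finite classes. *)
Lemma orbit_sum_ind (orb : A -> seq A) (Q : grpring R A -> Prop) f :
  (forall k, k \in orb k) -> (forall k, uniq (orb k)) ->
  (forall j k l, l \in orb j -> (l \in orb k) = (j \in orb k)) ->
  (forall k l, l \in orb k -> f@_l = f@_k) ->
  Q 0 -> (forall f g, Q f -> Q g -> Q (f + g)) ->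
  (forall k, f@_k != 0 -> Q (\sum_(l <- orb k) grpmon f@_k l)) ->
  Q f.
Proof.
move=> orb_refl orb_uniq orb_tr fE Q0 QD Qorb.
have [n] := ubnP #|` msupp f|; elim: n f fE Qorb => // n IHn f fE Qorb ltn.
have [f0|[k fk]] := fset_0Vmem (msupp f).
  suff -> : f = 0 by [].
  apply/grpringP => k; rewrite grpcoef0; apply/eqP.
  by rewrite -[_ == 0]negbK mcoeff_neq0 f0 inE.
(* The part of f on the class of [k]. Subtracting it removes the whole class from the support and
   leaves the other coefficients alone, which drives the induction on the size of the support. *)
set o := \sum_(l <- orb k) grpmon f@_k l.
have oE l : o@_l = f@_k *+ (l \in orb k).
  rewrite (big_morph (fun g : grpring R A => g@_l)
             (fun g1 g2 => grpcoefD g1 g2 l) (grpcoef0 l)).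
  rewrite -(count_uniq_mem _ (orb_uniq k)) -sum1_count -sumrMnr.
  rewrite [RHS]big_mkcond; apply: eq_bigr => j _ /=.
  by rewrite grpcoefU; case: eqP.
have fBoE l : (f - o)@_l = if l \in orb k then 0 else f@_l.
  by rewrite grpcoefB oE; case: ifP => [/fE ->|_]; rewrite (subrr, subr0).
rewrite -(subrK o f); apply: (QD) (Qorb k _); last by rewrite mcoeff_neq0.
apply: IHn => [j l lj|j|].
- by rewrite !fBoE (orb_tr _ _ _ lj) (fE _ _ lj).
- rewrite fBoE; case: ifP => [_|_ /Qorb //]; by rewrite eqxx.
rewrite ltnS in ltn; apply: leq_trans ltn.
apply/fproper_ltn_card; rewrite fproperE; apply/andP; split.
  apply/fsubsetP => l.
  by rewrite -!mcoeff_neq0 fBoE; case: ifP => // _; rewrite eqxx.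
by apply/fsubsetPn; exists k => //; rewrite -mcoeff_neq0 fBoE orb_refl eqxx.
Qed.

Lemma grpsymB_lreg k l f :
  injective (fun n : nat => (k - l) *+ n) -> injective (fun n : nat => (k + l) *+ n) ->
  (grpsym k - grpsym l) * f = 0 -> f = 0.
Proof.
move=> mI pI; rewrite grpsymB => /(congr1 ( *%R (grpexp R k))).
rewrite mulr0 -!mulrA [grpexp R k * _]mulrA grpexp_unit mul1r.
by move=> /(grpexpB1_lreg mI) /(grpexpB1_lreg pI).
Qed.

Lemma grpexpB1_dvd k (n : int) :
  exists q, grpexp R (k *~ n) - 1 = q * (grpexp R k - 1).
Proof.
have pos (m : nat) : exists q, grpexp R (k *+ m) - 1 = q * (grpexp R k - 1).
  elim: m => [|m [q IHm]]; first by exists 0; rewrite mul0r mulr0n subrr.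
  exists (grpexp R (k *+ m) + q).
  by rewrite mulrSr grpexpD mulrDl -IHm; ring.
case: n => m; first exact: pos.
(* For a negative multiple: e^(-mk) - 1 = - e^(-mk) (e^(mk) - 1). *)
have [q qE] := pos m.+1; exists (- grpexp R (- (k *+ m.+1)) * q).
by rewrite NegzE mulrNz -pmulrn -mulrA -qE mulrBr mulNr mulrC grpexp_unit; ring.
Qed.
End GroupRingTheory.

(** * Generated subrings and values of integer polynomials *)

Section SubringGen.
Variables (R : nzRingType) (S : R -> Prop).
Implicit Types x y : R.

Lemma subring_gen0 : subring_gen S 0.
Proof. by rewrite -(subrr 1); apply: subring_gen_B; exact: subring_gen_1. Qed.

Lemma subring_genN x : subring_gen S x -> subring_gen S (- x).
Proof. by rewrite -sub0r; apply: subring_gen_B; exact: subring_gen0. Qed.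

Lemma subring_genD x y :
  subring_gen S x -> subring_gen S y -> subring_gen S (x + y).
Proof. by move=> Sx /subring_genN; rewrite -{2}[y]opprK; apply: subring_gen_B. Qed.

Lemma subring_genMz x (n : int) : subring_gen S x -> subring_gen S (x *~ n).
Proof.
move=> Sx; have Sxn m : subring_gen S (x *+ m).
  elim: m => [|m IHm]; rewrite ?mulrS; [exact: subring_gen0|exact: subring_genD].
by case: n => m; [exact: Sxn | exact: subring_genN (Sxn m.+1)].
Qed.
End SubringGen.

(** Passes between Z[x] as a generated subring, suited to inductions, and as the set of values g(x),
    the form taken by g(w) in the theorem. *)
Lemma subring_gen_eq1P (R : comNzRingType) (x y : R) :
  subring_gen (eq^~ x) y <-> exists g : {poly int}, y = (map_poly intr g).[x].
Proof.
split=> [|[g ->{y}]].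
  elim=> {y} [y ->||y z _ [g1 ->] _ [g2 ->]|y z _ [g1 ->] _ [g2 ->]].
  - by exists 'X; rewrite map_polyX hornerX.
  - by exists 1; rewrite rmorph1 hornerE.
  - by exists (g1 - g2); rewrite rmorphB !hornerE.
  - by exists (g1 * g2); rewrite rmorphM hornerM.
elim/poly_ind: g => [|g c IHg]; first by rewrite rmorph0 horner0; apply: subring_gen0.
rewrite rmorphD rmorphM /= map_polyX map_polyC !hornerE.
apply: subring_genD; last by apply/subring_genMz/subring_gen_1.
by apply: subring_gen_M => //; apply: subring_gen_base.
Qed.

Lemma rmorph_horner_int (R1 R2 : comNzRingType) (phi : {rmorphism R1 -> R2})
    (g : {poly int}) x :
  phi (map_poly intr g).[x] = (map_poly intr g).[phi x].
Proof.
rewrite -horner_map -map_poly_comp; congr _.[_].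
by apply: eq_map_poly => n; rewrite /= rmorph_int.
Qed.

(** By the Leibniz rule the elements whose derivative lies in the ideal (e) form a subring; it
    contains x, hence Z[x]. *)
Lemma grpder_horner_dvd (R : comNzRingType) (A : zmodType) (d : A -> R)
    (e x : grpring R A) (g : {poly int}) :
  {morph d : k l / k + l} -> (exists q, grpder d x = q * e) ->
  exists q, grpder d (map_poly intr g).[x] = q * e.
Proof.
move=> dD [q0 q0E].
have : subring_gen (eq^~ x) (map_poly intr g).[x] by apply/subring_gen_eq1P; exists g.
elim=> [_ ->||f1 f2 _ [q1 q1E] _ [q2 q2E]|f1 f2 _ [q1 q1E] _ [q2 q2E]].
- by exists q0.
- exists 0; rewrite mul0r; apply: (addIr (grpder d 1)).
  by rewrite add0r -{3}(mulr1 1) grpderM // mulr1 mul1r.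
- by exists (q1 - q2); rewrite raddfB /= q1E q2E mulrBl.
- by exists (q1 * f2 + f1 * q2); rewrite grpderM // q1E q2E; ring.
Qed.

(** * Symmetric expressions in three permuted elements *)

Section SymmetricOn3.
Variables (R : comNzRingType) (phi : {rmorphism R -> R}) (s : 'S_3).
Variables (x : R) (y : 'I_3 -> R).
Hypotheses (phi_x : phi x = x) (phi_y : forall i, phi (y i) = y (s i)).

Lemma big_I3 (V : Type) (idx : V) (op : Monoid.law idx) (F : 'I_3 -> V) :
  \big[op/idx]_i F i = op (op (F 0) (F 1)) (F 2).
Proof.
rewrite !big_ord_recl big_ord0 Monoid.mulm1 Monoid.mulmA.
by congr (op (op (F _) (F _)) (F _)); apply/val_inj.
Qed.

Lemma rmorph_sum_perm : phi (\sum_i y i) = \sum_i y i.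
Proof.
by rewrite rmorph_sum [RHS](reindex_inj (@perm_inj _ s)); apply: eq_bigr.
Qed.

Lemma rmorph_prod_perm (F : R -> R) :
  (forall z, phi (F z) = F (phi z)) -> phi (\prod_i F (y i)) = \prod_i F (y i).
Proof.
move=> phi_F; rewrite rmorph_prod [RHS](reindex_inj (@perm_inj _ s)).
by apply: eq_bigr => i _; rewrite phi_F phi_y.
Qed.

Lemma rmorph_prodB3 : phi ((x - y 0) * (x - y 1) * (x - y 2)) =
  (x - y 0) * (x - y 1) * (x - y 2).
Proof.
rewrite -(big_I3 _ (fun i => x - y i)) (rmorph_prod_perm (F := fun z => x - z)) //.
by move=> z; rewrite rmorphB phi_x.
Qed.

Lemma rmorph_w3 :
  let w := x ^+ 2 - x * (y 0 + y 1 + y 2 + 1) + y 0 * y 1 + y 0 * y 2 + y 1 * y 2 in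
  phi w = w.
Proof.
(* The second elementary symmetric polynomial is the product of the 1 + y_i minus 1, the sum and the
   product of the y_i; all these are sums or products over the whole index set. *)
move=> w; have -> : w = x ^+ 2 - x * (\sum_i y i + 1) +
    (\prod_i (1 + y i) - 1 - \sum_i y i - \prod_i y i).
  by rewrite !big_I3 /= /w; ring.
rewrite !(rmorphB, rmorphD, rmorphM, rmorphXn) /= rmorph1 phi_x rmorph_sum_perm.
rewrite (rmorph_prod_perm (F := id)) // (rmorph_prod_perm (F := fun z => 1 + z)) //.
by move=> z; rewrite rmorphD rmorph1.
Qed.
End SymmetricOn3.

(** * Membership of e^k + e^(-k) in a subring *)

Lemma subring_gen_grpsym (R : comNzRingType) (A : zmodType)
    (S : grpring R A -> Prop) (k l : A) (n : int) :
  subring_gen S (grpsym R l) -> subring_gen S (grpsym R k) ->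
  subring_gen S (grpsym R (k + l)) -> subring_gen S (grpsym R (k + l *~ n)).
Proof.
(* A Chebyshev recurrence: s(x - y) = s(x) s(y) - s(x + y) for s = [grpsym R]. Two neighbouring
   members of an arithmetic progression thus give the next one, in either direction. *)
have step (x y : A) : subring_gen S (grpsym R y) -> subring_gen S (grpsym R x) ->
    subring_gen S (grpsym R (x + y)) -> subring_gen S (grpsym R (x - y)).
  move=> Sy Sx Sxy.
  have -> : grpsym R (x - y) = grpsym R x * grpsym R y - grpsym R (x + y).
    by rewrite grpsymM addrAC subrr add0r.
  by apply: subring_gen_B => //; apply: subring_gen_M.
have pos (x y : A) (m : nat) : subring_gen S (grpsym R y) ->
    subring_gen S (grpsym R x) -> subring_gen S (grpsym R (x + y)) ->
    subring_gen S (grpsym R (x + y *+ m)).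
  move=> Sy Sx Sxy.
  suff [] : subring_gen S (grpsym R (x + y *+ m)) /\
      subring_gen S (grpsym R (x + y *+ m.+1)) by [].
  elim: m => [|m [IH1 IH2]]; first by rewrite mulr0n addr0.
  split=> //; rewrite mulrSr addrA -[y in _ + y]opprK.
  apply: step; rewrite ?grpsymN //.
  by rewrite mulrSr addrA addrK.
move=> Sl Sk Skl; case: n => m; first exact: pos.
rewrite NegzE mulrNz -mulNrz; apply: pos => //; first by rewrite grpsymN.
exact: step.
Qed.

Lemma subring_gen_grpsymMz (R : comNzRingType) (A : zmodType)
    (S : grpring R A -> Prop) (l : A) (n : int) :
  subring_gen S (grpsym R l) -> subring_gen S (grpsym R (l *~ n)).
Proof.
move=> Sl; rewrite -[l *~ n]add0r; apply: subring_gen_grpsym; rewrite ?add0r //.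
(* The progression starts at [grpsym R 0], which is 1 + 1. *)
by rewrite /grpsym oppr0 grpexp0; apply: subring_genD; exact: subring_gen_1.
Qed.

(** * Orbits of sign changes and their sums *)

Definition pm_seq (A : zmodType) (x : A) := undup [:: x; - x].

Lemma mem_pm_seq (A : zmodType) (x y : A) : (y \in pm_seq x) = (y == x) || (y == - x).
Proof. by rewrite mem_undup !inE. Qed.

Lemma pm_seq_trans (A : zmodType) (x y z : A) :
  y \in pm_seq x -> (y \in pm_seq z) = (x \in pm_seq z).
Proof.
by rewrite !mem_pm_seq => /orP[]/eqP-> //; rewrite eqr_opp eqr_oppLR orbC.
Qed.

Lemma big_pm_seq (V : nmodType) (A : zmodType) (x : A) (F : A -> V) :
  \sum_(y <- pm_seq x) F y = if x == - x then F x else F x + F (- x).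
Proof.
by rewrite /pm_seq /= inE; case: eqP => [e|_]; rewrite !big_cons !big_nil !addr0 -?e.
Qed.

Lemma grpmonE (A : zmodType) (c : int) (k : A) : grpmon c k = grpexp int k *~ c.
Proof.
have pos (n : nat) : grpmon n%:Z k = grpexp int k *+ n.
  elim: n => [|n IHn]; first by rewrite grpmon0.
  by rewrite -addn1 PoszD grpmonD IHn mulrnDr.
case: c => n; first exact: pos.
apply/eqP; rewrite NegzE mulrNz -pmulrn -pos -addr_eq0 -grpmonD.
by rewrite addNr grpmon0.
Qed.

(** The orbit of k under the maps [weyl 1 b c]: the two signs act independently on the eps-part
    [k.1] and the delta-part [k.2], so orbit sums factor. *)
Definition pm_orbit (k : P0) : seq P0 :=
  [seq (x, y) | x <- pm_seq k.1, y <- pm_seq k.2].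

Lemma mem_pm_orbit (k l : P0) :
  (l \in pm_orbit k) = (l.1 \in pm_seq k.1) && (l.2 \in pm_seq k.2).
Proof.
apply/allpairsP/andP => [[[x y] [? ? ->]] //|[l1 l2]].
by exists l; split=> //; case: l {l1 l2}.
Qed.

Lemma pm_orbit_sum (S : ZP0 -> Prop) (c : int) (k : P0) :
  subring_gen S (grpsym int ((k.1, 0) : P0)) ->
  subring_gen S (grpsym int ((0, k.2) : P0)) ->
  subring_gen S (\sum_(l <- pm_orbit k) grpmon c l).
Proof.
case: k => p m /= Sp Sm.
have -> : \sum_(l <- pm_orbit (p, m)) grpmon c l =
    ((\sum_(x <- pm_seq p) 'e^(x, 0)) * (\sum_(y <- pm_seq m) 'e^(0, y))) *~ c.
  rewrite /pm_orbit big_allpairs mulr_suml mulrz_suml; apply: eq_bigr => x _.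
  rewrite mulr_sumr mulrz_suml; apply: eq_bigr => y _ /=.
  have -> : (x, y) = ((x, 0) : P0) + ((0, y) : P0).
    by rewrite [RHS]/GRing.add /= /add_pair /= addr0 add0r.
  by rewrite grpmonE grpexpD.
apply: subring_genMz; apply: subring_gen_M; rewrite big_pm_seq.
  (* A part equal to its opposite is zero; its orbit is a single point and contributes 1, not the
     value 2 of [grpsym] at 0. *)
  case: eqP Sp => // pN _; have -> : p = 0.
    by move: p pN => [a b] [aN bN]; congr pair; lia.
  exact: subring_gen_1.
case: eqP Sm => // mN _; have -> : m = 0 by lia.
exact: subring_gen_1.
Qed.

(** * Reduction modulo e^a - 1 *)

Section Projection.
Variables (R : comNzRingType) (A : zmodType) (deg : {additive A -> int}).
Implicit Types a b k : A.

(** When [deg a = 1], this is the projection along a onto the kernel of [deg]. *)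
Definition grpproj a k := k - a *~ deg k.

Lemma grpproj_is_zmod_morphism a : zmod_morphism (grpproj a).
Proof. by move=> k l; rewrite /grpproj raddfB mulrzBr !opprD !opprK addrACA. Qed.

HB.instance Definition _ a := GRing.isZmodMorphism.Build A A (grpproj a)
  (grpproj_is_zmod_morphism a).

(** Subtract from f its zero image: each monomial then contributes a multiple of e^(na) - 1 with n =
    [deg k], which e^a - 1 divides. *)
Lemma grpproj_ker_dvd a (f : grpring R A) :
  grpmap (grpproj a) f = 0 -> exists q, f = q * (grpexp R a - 1).
Proof.
move=> f0; rewrite -[f]subr0 -f0 {f0}.
elim/grpring_ind: f => [|f g [q IHf] [r IHg]|c k].
- by exists 0; rewrite raddf0 mul0r subr0.
- by exists (q + r); rewrite grpmapD mulrDl -IHf -IHg opprD addrACA.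
have [q qE] := grpexpB1_dvd R a (deg k); exists (grpmon c (grpproj a k) * q).
have {1}-> : grpmon c k = grpmon c (grpproj a k) * grpexp R (a *~ deg k).
  by rewrite grpmonM mulr1 subrK.
by rewrite grpmapU -mulrA -qE mulrBr mulr1.
Qed.

Lemma grpproj_expB1 a b : deg b = 1 ->
  grpmap (grpproj a) (grpexp R b - 1) = grpexp R (b - a) - 1.
Proof. by move=> b2; rewrite raddfB /= grpmap_exp rmorph1 /= /grpproj b2. Qed.

Lemma grpproj_mul_expB1 a (f : grpring R A) : deg a = 1 ->
  grpmap (grpproj a) (f * (grpexp R a - 1)) = 0.
Proof. by move=> a1; rewrite grpmapM /= grpproj_expB1 // subrr grpexp0 subrr mulr0. Qed.

Hypothesis torsion_free : forall k, k != 0 -> injective (fun n : nat => k *+ n).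

(** Induction on the list: write f as the product for the tail times q and project along the head a.
    Each factor becomes e^(b - a) - 1 with b distinct from a, which is no zero divisor; so q
    projects to 0 and is divisible by e^a - 1. *)
Lemma dvd_prod_expB1 (s : seq A) (f : grpring R A) :
  uniq s -> (forall a, a \in s -> deg a = 1) ->
  (forall a, a \in s -> grpmap (grpproj a) f = 0) ->
  exists q, f = (\prod_(a <- s) (grpexp R a - 1)) * q.
Proof.
elim: s => [|a s IHs] /=; first by exists f; rewrite big_nil mul1r.
case/andP=> a_s us s2 fs.
have [|b sb|b sb|q fE] := IHs _; rewrite ?s2 ?fs ?inE ?sb ?orbT //.
suff /grpproj_ker_dvd[r qE] : grpmap (grpproj a) q = 0.
  by exists r; rewrite fE qE big_cons; ring.
have: grpmap (grpproj a) f = 0 by apply: fs; rewrite inE eqxx.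
rewrite fE rmorphM rmorph_prod /=.
have {a_s fs s2 fE us IHs} : forall b, b \in s -> deg b = 1 /\ b != a.
  move=> b sb; split; first by apply: s2; rewrite inE sb orbT.
  by apply: contraNneq a_s => <-.
elim: s => [|b s IHs] sP; first by rewrite big_nil mul1r.
rewrite big_cons -mulrA grpproj_expB1; last by case: (sP b (mem_head _ _)).
move/grpexpB1_lreg => H; apply: IHs => [c sc|].
  by apply: sP; rewrite inE sc orbT.
by apply/H/torsion_free; case: (sP b (mem_head _ _)); rewrite subr_eq0.
Qed.
End Projection.

(** * The weight lattice and the group W_0 *)

Lemma P0_eqP (k l : P0) : k.1.1 = l.1.1 -> k.1.2 = l.1.2 -> k.2 = l.2 -> k = l.
Proof. by case: k l => [[k1 k2] k3] [[l1 l2] l3] /= -> -> ->. Qed.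

Lemma P0_mulrzE (k : P0) (n : int) : k *~ n = (k.1.1 * n, k.1.2 * n, k.2 * n).
Proof.
have E (j : nat) : k *+ j = (k.1.1 *+ j, k.1.2 *+ j, k.2 *+ j).
  by elim: j => [|j IHj] //; rewrite !mulrS IHj.
case: n => n; first by rewrite -pmulrn E; apply: P0_eqP => /=; rewrite -mulr_natr natz.
by rewrite NegzE mulrNz -pmulrn E; apply: P0_eqP => /=; rewrite mulrN -mulr_natr natz.
Qed.

Lemma P0_mulrn_inj (k : P0) : k != 0 -> injective (fun n : nat => k *+ n).
Proof.
move=> k0 m n /=; rewrite !pmulrn !P0_mulrzE => -[e1 e2 e3].
have [->//|/eqP mn] := eqVneq m n.
case/eqP: k0; apply: P0_eqP => /=; nia.
Qed.

Lemma P0E (k : P0) : k = eps 0 *~ k.1.1 + eps 1 *~ k.1.2 + delta *~ k.2.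
Proof.
rewrite !P0_mulrzE; apply: P0_eqP => /=; lia.
Qed.

Lemma weyl_is_zmod_morphism s b c : zmod_morphism (weyl s b c).
Proof.
move=> k l; rewrite /weyl !P0_mulrzE; apply: P0_eqP => /=; ring.
Qed.

HB.instance Definition _ s b c := GRing.isZmodMorphism.Build P0 P0 (weyl s b c)
  (weyl_is_zmod_morphism s b c).

Definition delta_deg : {additive P0 -> int} := snd.

Lemma P0_additive_ext (phi1 phi2 : {additive P0 -> P0}) :
  (forall i, phi1 (eps i) = phi2 (eps i)) -> phi1 delta = phi2 delta ->
  phi1 =1 phi2.
Proof.
by move=> phi_eps phi_delta k; rewrite [k]P0E !raddfD !raddfMz /= !phi_eps phi_delta.
Qed.

(** Products of permutations are read from left to right, whence [s2 * s1]. *)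
Lemma weyl_comp s1 s2 b1 b2 c1 c2 k :
  weyl s1 b1 c1 (weyl s2 b2 c2 k) = weyl (s2 * s1) (b1 (+) b2) (c1 (+) c2) k.
Proof.
apply: (@P0_additive_ext (weyl s1 b1 c1 \o weyl s2 b2 c2)) => [i|] /=.
  by rewrite !weyl_eps raddfMz /= weyl_eps permM -mulrzA signr_addb mulrC.
by rewrite !weyl_delta raddfMz /= weyl_delta -mulrzA signr_addb mulrC.
Qed.

Lemma weyl1 k : weyl 1 false false k = k.
Proof. by rewrite /weyl !perm1 !expr0 mulr1z mul1r -P0E. Qed.

Lemma weyl_inj s b c : injective (weyl s b c).
Proof.
apply: (can_inj (g := weyl s^-1 b c)) => k.
by rewrite weyl_comp mulgV !addbb weyl1.
Qed.

Lemma weyl_pm b c k :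
  weyl 1 b c k = ((k.1.1 * (-1) ^+ b, k.1.2 * (-1) ^+ b), k.2 * (-1) ^+ c).
Proof.
by rewrite /weyl !perm1 !P0_mulrzE; apply: P0_eqP => /=; ring.
Qed.

Lemma eps_deg i : (eps i).2 = 0.
Proof. by case: i => [[|[|[|?]]] ?]. Qed.

(** With no sign change on delta the delta-coordinate is preserved, so the Weyl element conjugates
    the projection along a into the one along its image. *)
Lemma delta_proj_weyl a s b k :
  grpproj delta_deg (weyl s b false a) (weyl s b false k) =
  weyl s b false (grpproj delta_deg a k).
Proof.
rewrite /grpproj raddfB raddfMz; congr (_ - _ *~ _).
by rewrite /weyl !P0_mulrzE /= !eps_deg; ring.
Qed.

Lemma delta_proj_map_weyl a s b f :
  grpmap (grpproj delta_deg (weyl s b false a)) (weyl_act s b false f) =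
  weyl_act s b false (grpmap (grpproj delta_deg a) f).
Proof.
rewrite /weyl_act !grpmap_comp; apply: eq_grpmap => k /=; exact: delta_proj_weyl.
Qed.

(** * Action of W_0 on the u_i, v, the form and the isotropic roots *)

Lemma u_sym i : u i = grpsym int (eps i).
Proof. by []. Qed.

Lemma v_sym : v = grpsym int delta.
Proof. by []. Qed.

Lemma weyl_actB s b c : {morph weyl_act s b c : f g / f - g}.
Proof. exact: grpmapB. Qed.

Lemma weyl_actM s b c : {morph weyl_act s b c : f g / f * g}.
Proof. exact: (grpmapM (weyl s b c)). Qed.

Lemma weyl_act_expB1 s b c k : weyl_act s b c ('e^k - 1) = 'e^(weyl s b c k) - 1.
Proof. exact: (grpmap_expB1 int (weyl s b c)). Qed.

Lemma weyl_act_u s b c i : weyl_act s b c (u i) = u (s i).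
Proof.
rewrite u_sym /weyl_act (grpmap_sym int (weyl s b c)) /= weyl_eps.
by case: b; rewrite ?expr1 ?mulrN1z ?grpsymN.
Qed.

Lemma weyl_act_v s b c : weyl_act s b c v = v.
Proof.
rewrite v_sym /weyl_act (grpmap_sym int (weyl s b c)) /= weyl_delta.
by case: c; rewrite ?expr1 ?mulrN1z ?grpsymN.
Qed.

(** By bilinearity only the Gram matrix of [eps (s 0)] and [eps (s 1)] enters, which does not depend
    on s; the signs occur squared. *)
Lemma bform_weyl s b c k l : bform (weyl s b c k) (weyl s b c l) = bform k l.
Proof.
have xx i : bform (eps (s i)) (eps (s i)) = 2 by rewrite bform_eps eqxx.
have xy : bform (eps (s 0)) (eps (s 1)) = -1.
  by rewrite bform_eps (inj_eq perm_inj).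
have sgn (d : bool) : (-1) ^+ d * (-1) ^+ d = 1 :> int by rewrite -expr2 sqrr_sign.
transitivity ((k.1.1 * l.1.1 * bform (eps (s 0)) (eps (s 0))
   + (k.1.1 * l.1.2 + k.1.2 * l.1.1) * bform (eps (s 0)) (eps (s 1))
   + k.1.2 * l.1.2 * bform (eps (s 1)) (eps (s 1))) * ((-1) ^+ b * (-1) ^+ b)
   - 2 * (k.2 * l.2) * ((-1) ^+ c * (-1) ^+ c)).
  by rewrite /weyl !P0_mulrzE /bform /= !eps_deg; ring.
by rewrite !xx xy !sgn /bform; ring.
Qed.

Lemma D_weyl_act s b c a f :
  D (weyl s b c a) (weyl_act s b c f) = weyl_act s b c (D a f).
Proof.
have e : bform (weyl s b c a) \o weyl s b c =1 bform a.
  by move=> k /=; rewrite bform_weyl.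
by rewrite /D /weyl_act grpder_map (eq_grpder f e).
Qed.

(** This is delta - eps_1 - eps_2, so e^alpha0 - 1 is a unit times y - x_1 x_2. *)
Definition alpha0 : P0 := delta + eps 2.

(** A transposition moves eps_3 to any eps_i and both signs are free, so W_0 is transitive on the
    isotropic roots. *)
Lemma isotropic_rootP a : isotropic_root a <-> exists s b c, a = weyl s b c alpha0.
Proof.
rewrite /alpha0; split=> [[i [b [c ->]]]|[s [b [c ->]]]].
  by exists (tperm 2 i), b, c; rewrite raddfD /= weyl_eps weyl_delta tpermL addrC.
by exists (s 2), b, c; rewrite raddfD /= weyl_eps weyl_delta addrC.
Qed.

(** For invariant f, transitivity of W_0 carries the divisibility at one root to all the others. *)
Lemma J_alpha0 f : (forall s b c, weyl_act s b c f = f) ->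
  J f <-> exists q : ZP0, D alpha0 f = q * ('e^alpha0 - 1).
Proof.
move=> fW; split=> [[_ fD]|[q fD]].
  by apply/fD/isotropic_rootP; exists 1%g, false, false; rewrite weyl1.
split=> // _ /isotropic_rootP[s [b [c ->]]]; exists (weyl_act s b c q).
rewrite -{1}(fW s b c) D_weyl_act fD weyl_actM weyl_act_expB1.
exact: erefl.
Qed.

(** * The element w modulo e^alpha0 - 1, and the inclusion into J *)

Definition wline : P0 := eps 0 - eps 1.

(** Division of w, as a polynomial in x = v, by x - c: the remainder is a b - c. *)
Lemma w_mod (R : comNzRingType) (x a b c t : R) : a * b = c + t ->
  x ^+ 2 - x * (a + b + c + 1) + a * b + a * c + b * c
  = t + (x - a - b - 1) * (x - c).
Proof. by move=> ab; ring: ab. Qed.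

Lemma u12 : u1 * u2 = u3 + grpsym int wline.
Proof.
rewrite /u1 /u2 /u3 !u_sym grpsymM.
have -> : eps 0 + eps 1 = - eps 2 by exact: erefl.
by rewrite grpsymN.
Qed.

Lemma vBuE i :
  v - u i = 'e^(- delta) * ('e^(delta - eps i) - 1) * ('e^(delta + eps i) - 1).
Proof. exact: grpsymB. Qed.

Lemma w_alpha0 : w = grpsym int wline +
  (v - u1 - u2 - 1) * ('e^(- delta) * ('e^(delta - eps 2) - 1)) * ('e^alpha0 - 1).
Proof.
transitivity (grpsym int wline + (v - u1 - u2 - 1) * (v - u3)).
  exact: w_mod u12.
by rewrite -mulrA; congr (_ + _ * _); exact: (vBuE 2).
Qed.

Lemma bformD a : {morph bform a : k l / k + l}.
Proof. by move=> k l; rewrite /bform /=; ring. Qed.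

Lemma D_alpha0_mul f : D alpha0 (f * ('e^alpha0 - 1)) = D alpha0 f * ('e^alpha0 - 1).
Proof.
have e : bform alpha0 alpha0 = 0 by [].
exact: (@grpder_expB1_mul int P0 (bform alpha0) (bformD alpha0) alpha0 f e).
Qed.

(** As [wline] is orthogonal to [alpha0], the first term of [w_alpha0] is killed; the second stays
    in the ideal. *)
Lemma D_alpha0_w : exists q : ZP0, D alpha0 w = q * ('e^alpha0 - 1).
Proof.
eexists; rewrite w_alpha0 /D [LHS]grpderD.
have -> : grpder (bform alpha0) (grpsym int wline) = 0.
  exact: (@grpder_sym int P0 (bform alpha0)).
rewrite add0r; exact: D_alpha0_mul.
Qed.

Lemma weyl_act_w s b c : weyl_act s b c w = w.
Proof.
exact: (@rmorph_w3 ZP0 (grpmap (weyl s b c)) s v u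
          (weyl_act_v s b c) (weyl_act_u s b c)).
Qed.

Lemma weyl_act_prod s b c :
  weyl_act s b c ((v - u1) * (v - u2) * (v - u3)) = (v - u1) * (v - u2) * (v - u3).
Proof.
exact: (@rmorph_prodB3 ZP0 (grpmap (weyl s b c)) s v u
          (weyl_act_v s b c) (weyl_act_u s b c)).
Qed.

Lemma weyl_act_comp s1 s2 b1 b2 c1 c2 f :
  weyl_act s1 b1 c1 (weyl_act s2 b2 c2 f) =
  weyl_act (s2 * s1) (b1 (+) b2) (c1 (+) c2) f.
Proof.
rewrite /weyl_act grpmap_comp; apply: eq_grpmap => k /=; exact: weyl_comp.
Qed.

Lemma Zuv_weyl_act1 h b c : Zuv h -> weyl_act 1 b c h = h.
Proof.
elim=> {h} [h [->|[i ->]]||f g _ fE _ gE|f g _ fE _ gE].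
- exact: weyl_act_v.
- by rewrite weyl_act_u perm1.
- exact: (grpmap1 int (weyl 1 b c)).
- by rewrite weyl_actB fE gE.
- by rewrite weyl_actM fE gE.
Qed.

(** An element of W_0 is a permutation composed with sign changes, and the latter fix every u_i and
    v. *)
Lemma ZuvS3_weyl_act h s b c : ZuvS3 h -> weyl_act s b c h = h.
Proof.
case=> hZ hS; rewrite -[RHS](hS s) -{2}(Zuv_weyl_act1 b c hZ).
by rewrite weyl_act_comp mul1g.
Qed.

Lemma D_alpha0_horner_w (g : {poly int}) :
  exists q : ZP0, D alpha0 (map_poly intr g).[w] = q * ('e^alpha0 - 1).
Proof.
exact: (@grpder_horner_dvd int P0 (bform alpha0) _ w g (bformD alpha0) D_alpha0_w).
Qed.

Lemma weyl_act_horner_w (g : {poly int}) s b c :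
  weyl_act s b c (map_poly intr g).[w] = (map_poly intr g).[w].
Proof.
transitivity ((map_poly intr g).[weyl_act s b c w]).
  exact: (rmorph_horner_int (grpmap (weyl s b c))).
by rewrite weyl_act_w.
Qed.

Lemma weyl_actD s b c : {morph weyl_act s b c : f g / f + g}.
Proof. exact: grpmapD. Qed.

Lemma mulr_factor4 (R : comNzRingType) (a b c d e h : R) :
  c = d * e -> a * b * c * h = a * b * h * d * e.
Proof. by move=> ->; ring. Qed.

Lemma J_horner_w_add (g : {poly int}) h : ZuvS3 h ->
  J ((map_poly intr g).[w] + (v - u1) * (v - u2) * (v - u3) * h).
Proof.
move=> hZ; apply/J_alpha0 => [s b c|].
  rewrite weyl_actD weyl_act_horner_w weyl_actM weyl_act_prod.
  by rewrite (ZuvS3_weyl_act _ _ _ hZ).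
have [q qE] := D_alpha0_horner_w g.
(* The cofactor of e^alpha0 - 1, which is one of the factors of v - u_3. *)
pose y := (v - u1) * (v - u2) * h * ('e^(- delta) * ('e^(delta - eps 2) - 1)).
have -> : (v - u1) * (v - u2) * (v - u3) * h = y * ('e^alpha0 - 1).
  exact: mulr_factor4 (vBuE 2).
exists (q + D alpha0 y); rewrite mulrDl -qE -D_alpha0_mul; exact: grpderD.
Qed.

(** * The image of J under the projection along alpha0 *)

Definition proj0 : {additive P0 -> P0} := grpproj delta_deg alpha0.

Lemma bform_proj0 k : bform alpha0 (proj0 k) = bform alpha0 k.
Proof. by rewrite /proj0 /= /grpproj P0_mulrzE /bform /=; ring. Qed.

Lemma proj0_deg k : (proj0 k).2 = 0.
Proof. by rewrite /proj0 /= /grpproj P0_mulrzE /=; ring. Qed.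

Lemma wlineP k : bform alpha0 k = 0 -> k.2 = 0 -> k = wline *~ k.1.1.
Proof.
rewrite /bform P0_mulrzE /= => b0 k20; apply: P0_eqP => /=; lia.
Qed.

(** The projection kills the ideal (e^alpha0 - 1) and commutes with [D alpha0], so [D alpha0]
    annihilates the image of f; a nonzero coefficient at k forces (alpha0, k) = 0. *)
Lemma proj0_supp f k : J f -> (grpmap proj0 f)@_k != 0 -> k = wline *~ k.1.1.
Proof.
move=> [_ fD] fk; apply: wlineP; last first.
  have [l ->] := grpcoef_map_neq0 fk; exact: proj0_deg.
have [|q qE] := fD alpha0.
  by apply/isotropic_rootP; exists 1%g, false, false; rewrite weyl1.
have e : bform alpha0 \o proj0 =1 bform alpha0 by move=> l; exact: bform_proj0.
have : D alpha0 (grpmap proj0 f) = 0.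
  rewrite /D grpder_map (eq_grpder f e) -/(D alpha0 f) qE.
  exact: (@grpproj_mul_expB1 int P0 delta_deg alpha0).
move/(congr1 (fun g : ZP0 => g@_k)); rewrite /D grpcoef_der grpcoef0 => /eqP.
by rewrite mulf_eq0 (negPf fk) orbF => /eqP.
Qed.

(** The transposition of eps_1 and eps_2 fixes [alpha0], hence commutes with the projection. *)
Lemma proj0_swap f k : J f ->
  (grpmap proj0 f)@_(weyl (tperm 0 1) false false k) = (grpmap proj0 f)@_k.
Proof.
move=> [fW _]; rewrite -[in LHS](fW (tperm 0 1) false false).
have a0 : alpha0 = weyl (tperm 0 1) false false alpha0.
  by rewrite raddfD /= weyl_delta weyl_eps tpermD.
rewrite /proj0 {1}a0 delta_proj_map_weyl.
exact: (grpcoef_map_inj _ _ (@weyl_inj _ _ _)).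
Qed.

Lemma weyl_swap_wline (n : int) :
  weyl (tperm 0 1) false false (wline *~ n) = - (wline *~ n).
Proof.
rewrite raddfMz /= -mulNrz; congr (_ *~ n).
rewrite raddfB /= !weyl_eps tpermL tpermR; exact: erefl.
Qed.

Lemma proj0_even f k : J f -> (grpmap proj0 f)@_(- k) = (grpmap proj0 f)@_k.
Proof.
move=> fJ; have swap l : (grpmap proj0 f)@_l != 0 ->
    (grpmap proj0 f)@_(- l) = (grpmap proj0 f)@_l.
  by move=> /(proj0_supp fJ) ->; rewrite -weyl_swap_wline proj0_swap.
(* On the support, negation agrees with the swap; this settles the case where the coefficient at k
   or at - k is nonzero. *)
have [k0|/swap//] := eqVneq (grpmap proj0 f)@_k 0.
have [Nk0|/swap] := eqVneq (grpmap proj0 f)@_(- k) 0; first by rewrite k0 Nk0.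
by rewrite opprK => ->.
Qed.

Lemma proj0_poly f : J f ->
  exists g : {poly int}, grpmap proj0 f = (map_poly intr g).[grpsym int wline].
Proof.
move=> fJ; apply/subring_gen_eq1P.
apply: (@orbit_sum_ind int P0 (@pm_seq P0)) => [k|k|j k l|k l||f1 f2|k fk].
- by rewrite mem_pm_seq eqxx.
- exact: undup_uniq.
- exact: pm_seq_trans.
- by rewrite mem_pm_seq => /orP[]/eqP -> //; exact: proj0_even.
- exact: subring_gen0.
- exact: subring_genD.
have S k' : subring_gen (eq^~ (grpsym int wline)) (grpsym int (wline *~ k')).
  have Sl : subring_gen (eq^~ (grpsym int wline)) (grpsym int wline).
    by apply: subring_gen_base.
  exact: subring_gen_grpsymMz.
rewrite big_pm_seq; case: eqP => [kN|_].
  have -> : k = 0.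
    by case: k kN {fk} => [[k1 k2] k3] [N1 N2 N3]; apply: P0_eqP => /=; lia.
  rewrite grpmonE; apply: subring_genMz; exact: subring_gen_1.
rewrite !grpmonE -mulrzDl; apply: subring_genMz.
rewrite (proj0_supp fJ fk); exact: S.
Qed.

(** * Elements invariant under sign changes lie in Z[u_1, u_2, u_3, v] *)

Lemma weyl_act_eqP s b c f k : weyl_act s b c f = f -> f@_(weyl s b c k) = f@_k.
Proof.
by move=> fE; rewrite -{1}fE; exact: (grpcoef_map_inj _ _ (@weyl_inj _ _ _)).
Qed.

Lemma Zuv_grpsym_eps p : Zuv (grpsym int ((p, 0) : P0)).
Proof.
have Zu i : Zuv (grpsym int (eps i)) by apply: subring_gen_base; right; exists i.
case: p => p1 p2.
have -> : ((p1, p2, 0) : P0) = eps 0 *~ p1 + eps 1 *~ p2.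
  by rewrite !P0_mulrzE; apply: P0_eqP => /=; lia.
(* Two progressions are run, along eps_1 from eps_2 and then along eps_2; the mixed start eps_1 +
   eps_2 = - eps_3 is where u_3 enters. *)
have e01 : eps 1 + eps 0 = - eps 2 by [].
have Zu01 : Zuv (grpsym int (eps 1 + eps 0)) by rewrite e01 grpsymN.
apply: subring_gen_grpsym; first exact: Zu.
  exact/subring_gen_grpsymMz/Zu.
rewrite addrC; apply: subring_gen_grpsym; [exact: Zu|exact: Zu|exact: Zu01].
Qed.

Lemma Zuv_grpsym_delta (m : int) : Zuv (grpsym int ((0, m) : P0)).
Proof.
have Zv : Zuv (grpsym int delta) by apply: subring_gen_base; left.
have -> : ((0, m) : P0) = delta *~ m.
  by rewrite P0_mulrzE; apply: P0_eqP => /=; lia.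
exact: subring_gen_grpsymMz.
Qed.

Lemma invariant_Zuv f : (forall b c, weyl_act 1 b c f = f) -> Zuv f.
Proof.
move=> fW; apply: (@orbit_sum_ind int P0 pm_orbit) => [k|k|j k l|k l||f1 f2|k fk].
- by rewrite mem_pm_orbit !mem_pm_seq !eqxx.
- by apply: allpairs_uniq; rewrite ?undup_uniq // => -[? ?] [? ?] _ _ [-> ->].
- rewrite !mem_pm_orbit => /andP[l1 l2].
  by rewrite (pm_seq_trans _ l1) (pm_seq_trans _ l2).
- rewrite mem_pm_orbit !mem_pm_seq => /andP[l1 l2].
  have [b [c ->]] : exists b c, l = weyl 1 b c k.
    (* A sign is applied exactly to the parts where l differs from k. *)
    exists (l.1 != k.1), (l.2 != k.2); rewrite weyl_pm.
    case: l k l1 l2 {fW} => [[l1 l2] l3] [[k1 k2] k3] /= H1 H2; apply: P0_eqP => /=.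
    + by case: eqP H1 => [[-> _]|_ /= /eqP[-> _]]; rewrite /= ?mulr1 ?mulrN1.
    + by case: eqP H1 => [[_ ->]|_ /= /eqP[_ ->]]; rewrite /= ?mulr1 ?mulrN1.
    + by case: eqP H2 => [->|_ /= /eqP ->]; rewrite /= ?mulr1 ?mulrN1.
  exact: weyl_act_eqP.
- exact: subring_gen0.
- exact: subring_genD.
by apply: pm_orbit_sum; [exact: Zuv_grpsym_eps | exact: Zuv_grpsym_delta].
Qed.

(** * Divisibility by (v - u_1)(v - u_2)(v - u_3) *)

Lemma eps_neq0 i : delta + eps i != 0 /\ delta - eps i != 0.
Proof. by case: i => [[|[|[|//]]] lti]. Qed.

Lemma vBu_lreg i f : (v - u i) * f = 0 -> f = 0.
Proof.
by apply: grpsymB_lreg; apply: P0_mulrn_inj; case: (eps_neq0 i).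
Qed.

Lemma prod_vBu_lreg f : (v - u1) * (v - u2) * (v - u3) * f = 0 -> f = 0.
Proof.
by rewrite -!mulrA => /(@vBu_lreg 0) /(@vBu_lreg 1) /(@vBu_lreg 2).
Qed.

(** Listed in pairs, in the order of the factors of [v - u i] in [vBuE]. *)
Definition roots6 : seq P0 :=
  [:: delta - eps 0; delta + eps 0; delta - eps 1; delta + eps 1;
      delta - eps 2; delta + eps 2].

(** The sign of delta is kept, so that [delta_proj_map_weyl] applies to the Weyl element found. *)
Lemma roots6P a : a \in roots6 -> exists s b, a = weyl s b false alpha0.
Proof.
have H i (b : bool) : exists s b', delta + eps i *~ (-1) ^+ b = weyl s b' false alpha0.
  by exists (tperm 2 i), b; rewrite raddfD /= weyl_eps weyl_delta tpermL.
have Hp i : exists s b', delta + eps i = weyl s b' false alpha0 by have := H i false.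
have Hn i : exists s b', delta - eps i = weyl s b' false alpha0 by have := H i true.
rewrite !inE => /or4P[|||/or3P[]] /eqP->;
  [exact: (Hn 0) | exact: (Hp 0) | exact: (Hn 1)
  |exact: (Hp 1) | exact: (Hn 2) | exact: (Hp 2)].
Qed.

Lemma prod6_factor (R : comNzRingType) (x y a b c a1 b1 a2 b2 a3 b3 q : R) :
  x * y = 1 -> a = y * a1 * b1 -> b = y * a2 * b2 -> c = y * a3 * b3 ->
  a1 * (b1 * (a2 * (b2 * (a3 * (b3 * 1))))) * q = a * b * c * (x * x * x * q).
Proof.
move=> xy -> -> ->.
transitivity ((x * y) ^+ 3 * (a1 * (b1 * (a2 * (b2 * (a3 * (b3 * 1))))) * q)).
  by rewrite xy expr1n mul1r.
by ring.
Qed.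

Lemma proj0_dvd f : (forall s b c, weyl_act s b c f = f) -> grpmap proj0 f = 0 ->
  exists h, f = (v - u1) * (v - u2) * (v - u3) * h.
Proof.
move=> fW f0.
have [//|a|a|q ->] := @dvd_prod_expB1 int P0 delta_deg P0_mulrn_inj roots6 f.
- by rewrite !inE => /or4P[|||/or3P[]] /eqP->.
- move=> /roots6P[s [b ->]]; rewrite -(fW s b false) delta_proj_map_weyl.
  by rewrite f0 /weyl_act grpmap0.
(* Compensates the three units e^(-delta) of the factors v - u_i. *)
exists ('e^delta * 'e^delta * 'e^delta * q).
rewrite /roots6 !big_cons big_nil.
exact: (prod6_factor q (grpexp_unit int delta) (vBuE 0) (vBuE 1) (vBuE 2)).
Qed.

(** * Decomposition of the elements of J *)

Lemma mulr_lreg (R : nzRingType) (p x y z : R) :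
  (forall t, p * t = 0 -> t = 0) -> p * x = z -> p * y = z -> x = y.
Proof.
move=> p_reg px py; apply/eqP; rewrite -subr_eq0; apply/eqP/p_reg.
by rewrite mulrBr px py subrr.
Qed.

Lemma J_decomp f : J f -> exists (g : {poly int}) (h : ZP0),
  ZuvS3 h /\ f = (map_poly intr g).[w] + (v - u1) * (v - u2) * (v - u3) * h.
Proof.
move=> fJ; have [g gE] := proj0_poly fJ; have [fW _] := fJ.
pose f1 := f - (map_poly intr g).[w].
have f1W s b c : weyl_act s b c f1 = f1 by rewrite weyl_actB fW weyl_act_horner_w.
have proj0_w : grpmap proj0 w = grpsym int wline.
  rewrite w_alpha0 grpmapD (@grpproj_mul_expB1 int P0 delta_deg alpha0) // addr0.
  exact: (grpmap_sym int proj0).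
have f10 : grpmap proj0 f1 = 0.
  rewrite grpmapB gE.
  have -> : grpmap proj0 (map_poly intr g).[w] = (map_poly intr g).[grpmap proj0 w].
    exact: (rmorph_horner_int (grpmap proj0)).
  by rewrite proj0_w subrr.
have [h hE] := proj0_dvd f1W f10.
(* Both h and its transform are cofactors of the same invariant product in the invariant [f1], and
   that product is not a zero divisor. *)
have hW s b c : weyl_act s b c h = h.
  have wh : (v - u1) * (v - u2) * (v - u3) * weyl_act s b c h = f1.
    rewrite -[RHS](f1W s b c) [in RHS]hE weyl_actM weyl_act_prod; exact: erefl.
  exact: (mulr_lreg prod_vBu_lreg wh (esym hE)).
exists g, h; split; last by rewrite -hE addrC subrK.
by split=> [|s]; [apply: invariant_Zuv => b c; exact: hW | exact: hW].
Qed.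

Theorem proposition7p8 (f : ZP0) :
  J f <->
  exists (g : {poly int}) (h : ZP0),
    ZuvS3 h /\
    f = (map_poly intr g).[w] + (v - u1) * (v - u2) * (v - u3) * h.
Proof.
by split=> [/J_decomp//|[g [h [hZ ->]]]]; exact: J_horner_w_add.
Qed.
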